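(* A finite group $G$ is the union of any three distinct proper subgroups if and only if it is isomorphic to $C_2\times C_2$.
   Context: $C_2$ denotes the cyclic group of order $2$. The union of subgroups is the set-theoretic union.
   Formalization: ''Proper subgroup'' is taken to mean proper and nontrivial (with {1} allowed, C2×C2 itself fails), and G is required to have at least three such subgroups (otherwise e.g. groups of prime order satisfy the condition vacuously). *)

(* Defs.v *)
From mathcomp Require Import all_boot all_fingroup zmodp.

Set Implicit Arguments.
Unset Strict Implicit.
Unset Printing Implicit Defensive.

Local Open Scope group_scope.

(* "Proper subgroup" is read as proper and nontrivial: if the trivial subgroup
   were allowed, C_2 x C_2 itself would not be the union of any three distinct
   proper subgroups (take 1 and two subgroups of order 2). *)
Definition nontrivial_proper (gT : finGroupType) (G H : {group gT}) : bool :=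
  (H :!=: 1) && (H \proper G).

Definition three_proper_subgroups (gT : finGroupType)
    (G H1 H2 H3 : {group gT}) : bool :=
  [&& nontrivial_proper G H1, nontrivial_proper G H2, nontrivial_proper G H3
    & uniq [:: H1; H2; H3]].

(* The first clause excludes vacuous instances: 1, cyclic groups of prime
   order, C_(p^2), C_(p^3) and C_(pq) have fewer than three such subgroups. *)
Definition union_of_any_three (gT : finGroupType) (G : {group gT}) : Prop :=
  (exists H1 H2 H3 : {group gT}, three_proper_subgroups G H1 H2 H3) /\
  (forall H1 H2 H3 : {group gT}, three_proper_subgroups G H1 H2 H3 ->
     G :=: H1 :|: H2 :|: H3).

(* Main.v *)
(** Two proper subgroups never cover a group.  Hence, if any three distinct
    nontrivial proper subgroups cover G and A, B, C are three of them, then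
    A :&: B = 1, since otherwise A :&: B, A, B would be a covering triple and
    already A, B would cover.  For a, a' in A^# and b in B^#, both a * b and
    a' * b lie in C, so that a * a'^-1 is in A :&: C = 1 and #|A| = 2.  Thus G
    has order 4 and exponent 2. *)
Require Import Defs.
From mathcomp Require Import all_boot all_fingroup zmodp.
From mathcomp Require Import cyclic pgroup abelian.

Set Implicit Arguments.
Unset Strict Implicit.
Unset Printing Implicit Defensive.

Local Open Scope group_scope.

(** For [x] in [G] outside [A] and [y] in [G] outside [B], the cover puts [x] in [B] and [y] in [A],
    so [x * y] lies in neither. *)
Lemma subgroup_setU (gT : finGroupType) (G A B : {group gT}) :
  G \subset A :|: B -> (G \subset A) || (G \subset B).
Proof.
move=> /subsetP sGAB; apply/orP.
have [sGA | /subsetPn[x Gx A'x]] := boolP (G \subset A); first by left.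
have [sGB | /subsetPn[y Gy B'y]] := boolP (G \subset B); first by right.
have Bx: x \in B by have:= sGAB x Gx; rewrite inE (negPf A'x).
have Ay: y \in A by have:= sGAB y Gy; rewrite inE (negPf B'y) orbF.
have:= sGAB _ (groupM Gx Gy).
by rewrite inE groupMr // (negPf A'x) groupMl // (negPf B'y).
Qed.

Lemma not_setU_proper (gT : finGroupType) (G A B : {group gT}) :
  A \proper G -> B \proper G -> G :<>: A :|: B.
Proof.
move=> /proper_subn/negPf nA /proper_subn/negPf nB defG.
by have:= @subgroup_setU _ G A B; rewrite -defG subxx nA nB => /(_ isT).
Qed.

Lemma trivg_capP (gT : finGroupType) (A B : {group gT}) x :
  A :&: B = 1 -> x \in A -> x \in B -> x = 1.
Proof. by move=> tiAB Ax Bx; apply/set1P; rewrite -[[set 1]]tiAB inE Ax. Qed.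

Lemma card_cover_TI3 (gT : finGroupType) (G A B C : {group gT}) :
    G :=: A :|: B :|: C -> A :!=: 1 -> B :!=: 1 ->
  A :&: B = 1 -> A :&: C = 1 -> #|A| = 2.
Proof.
move=> defG ntA ntB tiAB tiAC.
have [b Bb ntb] := trivgPn B ntB; have [a Aa nta] := trivgPn A ntA.
(* Were [x * b] in [A] or in [B], cancelling would put [b] or [x] in [A :&: B = 1]; only [C]
   remains. *)
have abC x : x \in A -> x != 1 -> x * b \in C.
  move=> Ax ntx; have: x * b \in G.
    by rewrite groupM // defG !inE ?Ax ?Bb ?orbT.
  rewrite defG !inE -orbA => /or3P[||//].
    by rewrite groupMl // => Ab; rewrite (trivg_capP tiAB Ab Bb) eqxx in ntb.
  by rewrite groupMr // => Bx; rewrite (trivg_capP tiAB Ax Bx) eqxx in ntx.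
suff ->: A :=: [set 1; a] by rewrite cards2 eq_sym nta.
apply/setP=> x; rewrite !inE; apply/idP/orP=> [Ax | [] /eqP-> //].
have [-> | ntx] := eqVneq x 1; [by left | right].
rewrite eq_mulgV1; apply/eqP/(trivg_capP tiAC); first by rewrite groupM ?groupV.
have ->: x * a^-1 = (x * b) * (a * b)^-1 by rewrite invMg mulgA mulgK.
by rewrite groupM ?groupV ?abC.
Qed.

(** Inclusion-exclusion: [(A :|: B) :&: C] is a union of two trivial intersections, so the count is
    [2 + 2 - 1 + 2 - 1]. *)
Lemma card_setU3_TI (gT : finGroupType) (A B C : {group gT}) :
    #|A| = 2 -> #|B| = 2 -> #|C| = 2 ->
  A :&: B = 1 -> A :&: C = 1 -> B :&: C = 1 -> #|A :|: B :|: C| = 4.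
Proof.
move=> oA oB oC tiAB tiAC tiBC.
by rewrite !cardsU setIUl tiAB tiAC tiBC setUid cards1 oA oB oC.
Qed.

Lemma prime_card_TI (gT : finGroupType) (A B : {group gT}) :
  prime #|A| -> #|A| = #|B| -> A != B -> A :&: B = 1.
Proof.
move=> pA eqAB neqAB; apply: prime_TIg => //; apply: contra neqAB => sAB.
by rewrite -val_eqE /= eqEcard sAB eqAB leqnn.
Qed.

(** For a fixed prime, elementary abelian groups are classified by their order. *)
Lemma isog_Z2Z2 (gT : finGroupType) (G : {group gT}) :
  G \isog [set: 'Z_2 * 'Z_2] = 2.-abelem G && (#|G| == 4).
Proof.
have abelZ : 2.-abelem [set: 'Z_2 * 'Z_2].
  apply/exponent2_abelem/exponentP=> -[x y] _.
  by apply/eqP; case: x y => [[|[]] //] ? [[|[]] //] ?.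
by rewrite isog_sym (isog_abelem_card _ abelZ) cardsT card_prod !card_ord.
Qed.

Lemma union_of_any_three_isog (gT : finGroupType) (G : {group gT}) :
  union_of_any_three G -> G \isog [set: 'Z_2 * 'Z_2].
Proof.
case=> [[A [B [C ABC]]] cover].
have TI (X Y Z : {group gT}) :
  three_proper_subgroups G X Y Z -> X :&: Y = 1 /\ X :&: Z = 1.
  (* The hypothesis is symmetric in [Y] and [Z], so the first intersection suffices. *)
  wlog suff: Y Z / three_proper_subgroups G X Y Z -> X :&: Y = 1.
    move=> IH XYZ; split; first exact: IH XYZ.
    apply: (IH Z Y); case/and4P: XYZ => pX pY pZ.
    rewrite /three_proper_subgroups pX pY pZ /= !inE (eq_sym Z Y).
    by rewrite orbC.
  move=> XYZ; have defG := cover _ _ _ XYZ; case/and4P: XYZ => pX pY pZ.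
  rewrite /= !inE negb_or -andbA => /and4P[neXY neXZ neYZ _].
  have [/andP[ntX prX] /andP[ntY prY] /andP[ntZ prZ]] := And3 pX pY pZ.
  apply/eqP; apply: contraT => ntXY.
  (* A member [T] of the cover that lies inside [V] is redundant, which leaves two proper subgroups
     covering [G]. *)
  have notsub (V W T : {group gT}) : V \proper G -> W \proper G ->
    G :=: T :|: V :|: W -> T \subset V -> False.
    move=> pV pW dG sTV; apply: (not_setU_proper pV pW).
    by rewrite dG (setUidPr sTV).
  have neX : (X :&: Y)%G != X.
    apply/eqP=> /(congr1 val)/= /setIidPl sXY.
    exact: notsub prY prZ defG sXY.
  have neY : (X :&: Y)%G != Y.
    apply/eqP=> /(congr1 val)/= /setIidPr sYX.
    by apply: notsub prX prZ _ sYX; rewrite (setUC Y).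
  have XYG : three_proper_subgroups G (X :&: Y)%G X Y.
    rewrite /three_proper_subgroups pX pY /nontrivial_proper ntXY /= !inE.
    by rewrite negb_or neX neY neXY (sub_proper_trans _ prX) ?subsetIl.
  by case: (notsub X Y (X :&: Y)%G prX prY (cover _ _ _ XYG) (subsetIl X Y)).
have [tiAB tiAC] := TI _ _ _ ABC; have defG := cover _ _ _ ABC.
(* Rotating the triple puts each subgroup first in turn, as [TI] and [card_cover_TI3] require. *)
have rot3 (X Y Z : {group gT}) :
  three_proper_subgroups G X Y Z -> three_proper_subgroups G Y Z X.
  case/and4P=> pX pY pZ U; apply/and4P; split=> //.
  by rewrite -(rot_uniq 1) in U.
have BCA := rot3 _ _ _ ABC; have CAB := rot3 _ _ _ BCA.
have [tiBC tiBA] := TI _ _ _ BCA; have [tiCA tiCB] := TI _ _ _ CAB.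
case/and4P: ABC => /andP[ntA _] /andP[ntB _] /andP[ntC _] _.
have oA : #|A| = 2 by apply: card_cover_TI3 defG ntA ntB tiAB tiAC.
have oB : #|B| = 2.
  by apply: card_cover_TI3 (cover _ _ _ BCA) ntB ntC tiBC tiBA.
have oC : #|C| = 2.
  by apply: card_cover_TI3 (cover _ _ _ CAB) ntC ntA tiCA tiCB.
rewrite isog_Z2Z2 {2}defG card_setU3_TI // eqxx andbT.
(* Each element of [G] lies in a subgroup of order 2, so it squares to 1; exponent 2 forces
   commutativity. *)
apply/exponent2_abelem/exponentP=> x; rewrite defG !inE -orbA.
by case/or3P=> Hx; [rewrite -oA | rewrite -oB | rewrite -oC]; apply: expg_cardG.
Qed.

(** By Lagrange, nontrivial proper subgroups of a group of order 4 have order 2, so three distinct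
    ones meet pairwise trivially and their union has 4 elements. The cycles of the three involutions
    form such a triple. *)
Lemma isog_union_of_any_three (gT : finGroupType) (G : {group gT}) :
  G \isog [set: 'Z_2 * 'Z_2] -> union_of_any_three G.
Proof.
rewrite isog_Z2Z2 => /andP[abelG /eqP oG].
have card2 (H : {group gT}) : nontrivial_proper G H -> #|H| = 2.
  case/andP; rewrite trivg_card1 => ntH prH.
  have := cardSg (proper_sub prH); have := proper_card prH; rewrite oG.
  by case: #|H| ntH => [|[|[|[|]]]].
have ox x : x \in G^# -> #[x] = 2.
  by case/setD1P=> ntx Gx; apply: abelem_order_p abelG Gx ntx.
split=> [|A B C ABC]; last first.
  case/and4P: (ABC) => pA pB pC; rewrite /= !inE negb_or -andbA.
  case/and4P=> neAB neAC neBC _.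
  have TI (X Y : {group gT}) : nontrivial_proper G X ->
    nontrivial_proper G Y -> X != Y -> X :&: Y = 1.
    by move=> /card2 oX /card2 oY; apply: prime_card_TI; rewrite oX.
  apply/esym/eqP; rewrite eqEcard oG card_setU3_TI ?card2 ?TI // leqnn andbT.
  by rewrite !subUset; apply/andP; split; [apply/andP; split |];
     apply: proper_sub; [case/andP: pA | case/andP: pB | case/andP: pC].
have : size (enum G^#) = 3.
  by rewrite -cardE; have:= cardsD1 1 G; rewrite group1 oG => -[].
have memE x : x \in enum G^# -> x \in G^# by rewrite mem_enum.
have : uniq (enum G^#) := enum_uniq _.
case: (enum _) memE => [|x [|y [|z []]]] //= memE Uxyz _.
have ncyc t : t \in [:: x; y; z] -> nontrivial_proper G <[t]>.
  move=> /memE Gt; have /setD1P[ntt Gt'] := Gt.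
  rewrite /nontrivial_proper cycle_eq1 ntt properEcard cycle_subG Gt'.
  by rewrite -orderE ox ?oG.
exists <[x]>%G, <[y]>%G, <[z]>%G; apply/and4P; split.
- by apply: ncyc; rewrite !inE eqxx.
- by apply: ncyc; rewrite !inE eqxx ?orbT.
- by apply: ncyc; rewrite !inE eqxx ?orbT.
(* Since [<[t]>] consists of [1] and [t], its only nontrivial element recovers [t]. *)
have inj : {in [:: x; y; z] &, injective (fun t => <[t]>%G)}.
  move=> s t /memE Gs /memE Gt /(congr1 val) /= eqst.
  have := cycle_id s; rewrite eqst (cycle2g (ox t Gt)) !inE.
  by case/setD1P: Gs => /negPf-> _ /eqP.
by rewrite -[[:: _; _; _]]/(map (fun t => <[t]>%G) [:: x; y; z]) map_inj_in_uniq.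
Qed.

Theorem corollaryC (gT : finGroupType) (G : {group gT}) :
  union_of_any_three G <-> G \isog [set: 'Z_2 * 'Z_2].
Proof.
split; [exact: union_of_any_three_isog | exact: isog_union_of_any_three].
Qed.
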